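(* Let $T$ and $V$ be subsets of $[1,n]$ such that for every $I\in\mathcal I[V]$, $|I\cap T|\le 1$. Write $S=[1,n]\setminus V$. For $P$ any rank $n+1$ Eulerian poset, $$\sum_{R\subseteq T}(-2)^{|T\setminus R|}f_{S\cup R}(P)\ge 0.$$ Equivalently, $$(-1)^{|T|}\sum_{T\subseteq Q\subseteq V}L_Q(P)\ge 0.$$
   Context: $[1,n]=\{1,\dots,n\}$. For $V\subseteq[1,n]$, $\mathcal I[V]$ denotes the collection of maximal intervals (of consecutive integers) contained in $V$. A graded poset is a finite partially ordered set $P$ with a unique minimum $\hat 0$, a unique maximum $\hat 1$, and a rank function $\rho:P\to\mathbf{N}$ with $\rho(\hat 0)=0$ and $\rho(y)-\rho(x)=1$ whenever $y$ covers $x$; its rank is $\rho(\hat 1)$. For $P$ of rank $n+1$ and $A\subseteq[1,n]$, $f_A(P)$ is the number of chains $x_1<\cdots<x_{|A|}$ in $P$ with $\{\rho(x_1),\dots,\rho(x_{|A|})\}=A$. $P$ is Eulerian if $\mu([x,y])=(-1)^{\rho(y)-\rho(x)}$ for every interval $[x,y]$ of $P$, where $\mu$ is the Möbius function, defined recursively by $\mu([x,x])=1$ and $\mu([x,y])=-\sum_{x\le z<y}\mu([x,z])$ for $x<y$. The flag $L$-vector of a graded poset $P$ of rank $n+1$ is $$L_A(P)=(-1)^{n-|A|}\sum_{B\supseteq[1,n]\setminus A}\left(-\tfrac12\right)^{|B|}f_B(P),\qquad A\subseteq[1,n],$$ where $B$ ranges over subsets of $[1,n]$.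
   Formalization: The formal theorem adds the hypothesis T ⊆ V, implicit in T ⊆ Q ⊆ V; without it the claim fails: for n=1, V=∅, T={1} and P the Boolean algebra of rank 2, the first sum is −2. *)

(* Defs.v *)
From HB Require Import structures.
From mathcomp Require Import all_boot all_order all_algebra.

Set Implicit Arguments.
Unset Strict Implicit.
Unset Printing Implicit Defensive.

Import Order.TTheory GRing.Theory Num.Theory.

Local Open Scope order_scope.
Local Open Scope ring_scope.

(* The set [1,n] is represented by 'I_n: the ordinal i stands for the integer
   i.+1.  Intervals and inclusions are insensitive to this shift; it only
   shows up when an index is compared with the rank of a poset element. *)

Definition is_interval n (I : {set 'I_n}) : bool :=
  [forall i in I, forall j in I, forall k : 'I_n,
     ((i <= k)%N && (k <= j)%N) ==> (k \in I)].

Definition max_intervals n (V : {set 'I_n}) : {set {set 'I_n}} :=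
  [set I | maxset (fun J : {set 'I_n} =>
                     [&& J != set0, is_interval J & J \subset V]) I].

Section Posets.
Variables (d : Order.disp_t) (P : finTBPOrderType d).
Implicit Types (x y z : P) (rho : P -> nat).

Definition covers y x : bool :=
  (x < y)%O && [forall z, ~~ ((x < z)%O && (z < y)%O)].

Definition graded_of_rank rho (m : nat) : Prop :=
  [/\ rho \bot%O = 0%N,
      forall x y, covers y x -> rho y = (rho x).+1
    & rho \top%O = m].

(* Recursion on fuel: the nested calls follow a strictly decreasing sequence of
   elements of P, so #|P| levels suffice (lemma mobius_lt). *)
Fixpoint mobius_fuel (k : nat) x y : int :=
  if k is k'.+1 then
    if x == y then 1
    else if (x < y)%O then
      - \sum_(z : P | (x <= z)%O && (z < y)%O) mobius_fuel k' x z
    else 0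
  else 0.

Definition mobius x y : int := mobius_fuel #|P| x y.

Lemma mobius_fuelE k l x y :
  (#|[set z : P | (z <= y)%O]| <= k)%N -> (#|[set z : P | (z <= y)%O]| <= l)%N ->
  mobius_fuel k x y = mobius_fuel l x y.
Proof.
have pos w : (0 < #|[set z : P | (z <= w)%O]|)%N.
  by apply/card_gt0P; exists w; rewrite inE.
elim: k l y => [|k IHk] [|l] y hk hl.
- by [].
- by have := leq_trans (pos y) hk.
- by have := leq_trans (pos y) hl.
rewrite /=; case: ifP => // _; case: ifP => // _; congr (- _).
apply: eq_bigr => z /andP[_ zy].
have lt : (#|[set w : P | (w <= z)%O]| < #|[set w : P | (w <= y)%O]|)%N.
  apply: proper_card; apply/properP; split.
    by apply/subsetP => w; rewrite !inE => wz; apply: le_trans wz (ltW zy).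
  by exists y; rewrite !inE ?lexx // lt_geF.
by apply: IHk; rewrite -ltnS; apply: leq_trans lt _.
Qed.

Lemma mobius_refl x : mobius x x = 1.
Proof.
have : (0 < #|P|)%N by apply/card_gt0P; exists x.
by rewrite /mobius; case: #|P| => //= k _; rewrite eqxx.
Qed.

Lemma mobius_lt x y :
  (x < y)%O -> mobius x y = - \sum_(z : P | (x <= z)%O && (z < y)%O) mobius x z.
Proof.
move=> xy; rewrite {1}/mobius (@mobius_fuelE _ #|P|.+1) ?max_card //=; last first.
  exact: leqW (max_card _).
by rewrite xy lt_eqF.
Qed.

Definition eulerian rho : Prop :=
  forall x y, (x <= y)%O -> mobius x y = (-1) ^+ (rho y - rho x)%N.

Definition is_flag_chain rho n (A : {set 'I_n}) (c : #|A|.-tuple P) : bool :=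
  [&& sorted <%O c,
      all (fun x => [exists i in A, rho x == i.+1]) c
    & [forall i in A, has (fun x => rho x == i.+1) c]].

Definition flag_f rho n (A : {set 'I_n}) : nat :=
  #|[set c : #|A|.-tuple P | is_flag_chain rho c]|.

Definition flag_L rho n (A : {set 'I_n}) : rat :=
  (-1) ^+ (n - #|A|)%N *
  \sum_(B : {set 'I_n} | ~: A \subset B) (- 2^-1) ^+ #|B| * (flag_f rho B)%:R.

End Posets.

(* Main.v *)
Require Import Defs.
From HB Require Import structures.
From mathcomp Require Import all_boot all_order all_algebra.
From mathcomp Require Import ring.

Set Implicit Arguments.
Unset Strict Implicit.
Unset Printing Implicit Defensive.

Import Order.TTheory GRing.Theory Num.Theory.
Local Open Scope ring_scope.

(* Write S for the complement of V. Elements of T lie in distinct gaps of S, so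
   a chain with rank set S :|: R is a chain h with rank set S together with, for
   each r in R independently, an element of rank r in the interval cut out by
   the neighbours of r in h. If N_r(h) counts these elements, the sum over R
   factors as \sum_h \prod_(r in T) (N_r(h) - 2). Every interval of rank 2 of
   an Eulerian poset has exactly two elements in the middle, hence an interval
   has at least two elements of each intermediate rank and all factors are
   nonnegative. Expanding the L-vector, the sum of signs over T <= Q <= V
   cancels all f_B except those with B = S :|: R, R \subset T, which shows that
   the second sum is 2^-(|S| + |T|) times the first. *)

(** * Expansions and alternating sums over subsets *)

Lemma prodrD_subset (R : comNzRingType) (I : finType) (T : {set I})
  (F G : I -> R) :
  \prod_(i in T) (F i + G i) =
  \sum_(J : {set I} | J \subset T)
     (\prod_(i in J) F i) * \prod_(i in T :\: J) G i.
Proof.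
(* Distributivity is applied over the whole index type. The value 0 of [F'] outside [T] kills every
   [J] not contained in [T], and the value 1 of [G'] leaves the other terms unchanged. *)
pose F' i := if i \in T then F i else 0.
pose G' i := if i \in T then G i else 1.
transitivity (\prod_i (F' i + G' i)).
  rewrite big_mkcond /=; apply: eq_bigr => i _.
  by rewrite /F' /G'; case: ifP; rewrite ?add0r.
rewrite (bigA_distr _ _ F' G') /= [RHS]big_mkcond /=; apply: eq_bigr => J _.
case: ifPn => [/subsetP JT | /subsetPn[i iJ iT]]; last first.
  by rewrite (bigD1 i) //= iJ /F' (negbTE iT) mul0r.
rewrite [X in X * _]big_mkcond [X in _ * X]big_mkcond -big_split /=.
apply: eq_bigr => i _; rewrite /F' /G' in_setD.
by case: ifPn => [/JT -> | _] /=; [rewrite mulr1 | rewrite mul1r].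
Qed.

(** Writing [Q = V :\: J] turns the sum, up to the sign of [~: V], into the expansion of a product
    of factors [-1 + 1] over [V :\: A], which vanishes unless that set is empty. *)
Lemma sum_sign_between (R : comNzRingType) (I : finType) (A V : {set I}) :
  \sum_(Q : {set I} | (A \subset Q) && (Q \subset V)) (-1) ^+ #|~: Q| =
  if A == V then (-1) ^+ #|~: V| else 0 :> R.
Proof.
case: ifPn => [/eqP <- | neqAV].
  rewrite (eq_bigl (pred1 A)) ?big_pred1_eq // => Q /=.
  by rewrite eq_sym eqEsubset.
have [AV | nAV] := boolP (A \subset V); last first.
  rewrite big_pred0 // => Q; apply/negP => /andP[AQ QV].
  by rewrite (subset_trans AQ QV) in nAV.
have /subsetPn[v vV vA] : ~~ (V \subset A).
  by apply: contra neqAV => VA; rewrite eqEsubset AV.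
rewrite (reindex_onto (fun J => V :\: J) (fun Q => V :\: Q)) /=; last first.
  by move=> Q /andP[_ QV]; rewrite setDDr setDv set0U; apply/setIidPr.
have := @prodrD_subset R I (V :\: A) (fun=> -1) (fun=> 1).
rewrite (bigD1 v) ?inE ?vA //= addNr mul0r => /esym.
under eq_bigr => J _ do rewrite prodr_const big1 // mulr1.
move/(congr1 ( *%R ((-1) ^+ #|~: V|))); rewrite mulr0 mulr_sumr => sum0.
rewrite -[RHS]sum0; apply: eq_big => [J | J /andP[_ /eqP JV]]; last first.
  rewrite -exprD -cardsUI; congr (_ ^+ _).
  have JsV : J \subset V by rewrite -JV subsetDl.
  have -> : ~: V :&: J = set0.
    by apply/eqP; rewrite setI_eq0 disjoint_sym disjoints_subset setCK.
  by rewrite cards0 addn0 setCD.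
rewrite subsetDl andbT setDDr setDv set0U.
apply/andP/subsetP => [[/subsetP AJ /eqP/setIidPr/subsetP JV] i iJ | JVA].
  by rewrite inE (JV _ iJ) andbT; apply/negP => /AJ; rewrite inE iJ.
split; last by apply/eqP/setIidPr/subsetP => i /JVA; rewrite inE => /andP[].
apply/subsetP => i iA; rewrite inE (subsetP AV _ iA) andbT.
by apply/negP => /JVA; rewrite inE iA.
Qed.

(** * Ranks and rank levels of intervals in Eulerian posets *)

Section GradedPosets.
Variables (d : Order.disp_t) (P : finTBPOrderType d) (rho : P -> nat).
Implicit Types x y z : P.

Lemma exists_coatom x y : (x < y)%O -> exists2 z, (x <= z)%O & covers y z.
Proof.
move=> xy; have Px : (x <= x < y)%O by rewrite lexx.
(* The size of the lower set is strictly increasing in [z], so a maximiser is a maximal element of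
   [[x,y)]. *)
case: (@arg_maxnP _ x (fun z => x <= z < y)%O
  (fun z => #|[set w : P | (w <= z)%O]|) Px) => z /andP[xz zy] zmax.
exists z => //; rewrite /covers zy; apply/forallP => w; apply/negP => /andP[zw wy].
have := zmax w; rewrite wy (le_trans xz (ltW zw)) => /(_ isT).
rewrite /= leqNgt => /negP; apply; apply/proper_card/properP; split.
  by apply/subsetP => u; rewrite !inE => uz; apply: le_trans uz (ltW zw).
by exists w; rewrite !inE ?lexx // lt_geF.
Qed.

Hypothesis rho_covers : forall x y, covers y x -> rho y = (rho x).+1.

Lemma rank_lt x y : (x < y)%O -> (rho x < rho y)%N.
Proof.
have [m] := ubnP #|[set w : P | (w <= y)%O]|.
elim: m y => // m IHm y; rewrite ltnS => ym xy.
have [z xz yz] := exists_coatom xy.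
rewrite (rho_covers yz) ltnS.
move: xz; rewrite le_eqVlt => /predU1P[-> // | xz].
apply/ltnW/IHm => //; apply: leq_trans ym.
have /andP[zy _] := yz; apply/proper_card/properP; split.
  by apply/subsetP => u; rewrite !inE => uz; apply: le_trans uz (ltW zy).
by exists y; rewrite !inE ?lexx // lt_geF.
Qed.

(** Descending from [y] through coatoms lowers the rank by exactly 1 each time, so no intermediate
    rank is skipped. *)
Lemma exists_rank_between x y k : (x <= y)%O -> (rho x <= k <= rho y)%N ->
  exists2 z, (x <= z <= y)%O & rho z = k.
Proof.
move=> xy /andP[xk /subnK]; move: (rho y - k)%N => m; rewrite addnC.
elim: m y xy => [|m IHm] y xy def_y.
  by exists y; rewrite ?xy ?lexx // -def_y addn0.
have {}xy : (x < y)%O.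
  rewrite lt_def xy andbT; apply: contraTneq xk => <-.
  by rewrite -def_y -ltnNge addnS ltnS leq_addr.
have [z xz yz] := exists_coatom xy.
have [|w /andP[xw wz] def_w] := IHm z xz.
  by apply: succn_inj; rewrite -(rho_covers yz) -def_y addnS.
have /andP[zy _] := yz.
by exists w; rewrite // xw (le_trans wz (ltW zy)).
Qed.

Hypothesis rho_eulerian : eulerian rho.

(** If m is the number of middle elements, each contributes -1 to the Möbius recursion, which reads
    1 = -(1 - m). *)
Lemma card_rank2_interval x y : (x < y)%O -> rho y = (rho x).+2 ->
  #|[set z | (x < z < y)%O]| = 2%N.
Proof.
move=> xy def_y.
have rho_mid z : (x < z < y)%O -> rho z = (rho x).+1.
  move=> /andP[/rank_lt xz /rank_lt zy]; apply/eqP; rewrite eqn_leq xz.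
  by rewrite -ltnS -def_y zy.
have := mobius_lt xy; rewrite rho_eulerian ?ltW // def_y -addn2 addKn sqrrN expr1n.
rewrite (bigD1 x) /= ?lexx // mobius_refl.
rewrite (eq_big (mem [set z | (x < z < y)%O]) (fun=> -1)) => [||z]; first last.
- move=> /andP[/andP[xz zy] zx]; rewrite rho_eulerian //.
  by rewrite (rho_mid z) ?subSnn ?expr1 // lt_def zx xz.
- by move=> z; rewrite !inE (lt_def x z) andbC andbA.
rewrite sumr_const mulNrn opprD opprK => /esym/eqP.
by rewrite addrC subr_eq -mulr2n eqr_nat => /eqP.
Qed.

(** Take [z] of rank k in [[x,y]], then [a] below it of rank k-1 and [b] above it of rank k+1. The
    two middle elements of [[a,b]] are as required. *)
Lemma card_rank_between x y k : (x <= y)%O -> (rho x < k < rho y)%N ->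
  (2 <= #|[set z | (x < z < y)%O & rho z == k]|)%N.
Proof.
move=> xy; case: k => // k /andP[xk ky].
have [|z /andP[xz zy] def_z] := @exists_rank_between x y k.+1 xy.
  by rewrite (ltnW xk) (ltnW ky).
have [|a /andP[xa az] def_a] := @exists_rank_between x z k xz.
  by rewrite def_z leqnSn andbT.
have [|b /andP[zb By] def_b] := @exists_rank_between z y k.+2 zy.
  by rewrite def_z leqnSn.
have ab : (a < b)%O.
  rewrite lt_def (le_trans az zb) andbT; apply: contra_eq_neq def_b => ->.
  by rewrite def_a ltn_eqF // leqW.
rewrite -(card_rank2_interval ab) ?def_a ?def_b //; apply/subset_leq_card.
apply/subsetP => w; rewrite !inE => /andP[aw wb].
rewrite (le_lt_trans xa aw) (lt_le_trans wb By) /=.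
by rewrite eqn_leq -ltnS -def_b rank_lt //= -def_a rank_lt.
Qed.

End GradedPosets.

(** * Chains as selections indexed by rank *)

Section FlagSelections.
Variables (d : Order.disp_t) (P : finTBPOrderType d) (rho : P -> nat).
Hypothesis rho_lt : forall x y : P, (x < y)%O -> (rho x < rho y)%N.
Variable n : nat.
Implicit Types (A R S : {set 'I_n}) (g h : {ffun 'I_n -> P}).

(* A chain with rank set [A], indexed by rank; [\bot] is only padding outside
   [A]. *)
Definition is_flag_selection A g : bool :=
  [forall i, if i \in A then rho (g i) == i.+1 else g i == \bot%O]
  && [forall i in A, forall j in A, (i < j)%N ==> (g i < g j)%O].

Lemma flag_selectionP A g :
  reflect [/\ forall i, i \in A -> rho (g i) = i.+1,
              forall i, i \notin A -> g i = \bot%O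
            & forall i j, i \in A -> j \in A -> (i < j)%N -> (g i < g j)%O]
          (is_flag_selection A g).
Proof.
apply: (iffP andP) => [[/forallP val_g /forall_inP lt_g] | [rho_g bot_g lt_g]].
  split=> i; [| |move=> j] => iA; last first.
  - by move=> jA ij; have /forall_inP/(_ j jA)/implyP := lt_g i iA; apply.
  - by have := val_g i; rewrite (negbTE iA) => /eqP.
  - by have := val_g i; rewrite iA => /eqP.
split; first by apply/forallP => i; case: ifPn => iA; rewrite ?rho_g ?bot_g.
apply/forall_inP => i iA; apply/forall_inP => j jA; apply/implyP.
exact: lt_g.
Qed.

(** Listing the values of a selection along [enum A] is a bijection onto flag chains. It is
    injective because the padding outside [A] is fixed. *)
Lemma flag_f_selections A :
  flag_f rho A = #|[set g | is_flag_selection A g]|.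
Proof.
have szA g : size (map g (enum A)) == #|A| by rewrite size_map cardE.
rewrite /flag_f -(@card_in_imset _ _ (fun g => Tuple (szA g))); last first.
  move=> g1 g2; rewrite !inE.
  move=> /flag_selectionP[_ bot1 _] /flag_selectionP[_ bot2 _].
  move=> /(congr1 val)/= /eq_in_map eq12; apply/ffunP => i.
  have [iA | iA] := boolP (i \in A); first by rewrite eq12 // mem_enum.
  by rewrite bot1 ?bot2.
have sorted_selection g : {in A &, {homo g : i j / (i < j)%N >-> (i < j)%O}} ->
    sorted <%O (map g (enum A)).
  move=> lt_g; have: sorted (relpre val ltn) (enum A).
    rewrite /enum_mem -enumT; apply: sorted_filter.
      by move=> ? ? ?; apply: ltn_trans.
    rewrite -sorted_map -[X in map _ X]/(enum 'I_n) val_enum_ord.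
    exact: iota_ltn_sorted.
  rewrite sorted_map; apply: (@sub_in_sorted _ (mem A)).
    by move=> i j iA jA; apply: lt_g.
  by apply/allP => i; rewrite mem_enum.
apply: eq_card => c; rewrite inE.
apply/idP/imsetP => [|[g]]; last first.
  rewrite inE => /flag_selectionP[rho_g _ lt_g] ->.
  apply/and3P; split; last 2 first.
  - apply/allP => x /mapP[i]; rewrite mem_enum => iA ->.
    by apply/existsP; exists i; rewrite iA rho_g /=.
  - apply/forall_inP => i iA; apply/hasP; exists (g i); last by rewrite rho_g.
    by apply: map_f; rewrite mem_enum.
  exact: sorted_selection.
move=> /and3P[c_sorted /allP rho_c /forall_inP c_rho].
(* Entries of a chain are comparable and [rho] is strictly increasing, so on [c] the order can be
   read off the ranks. *)
have c_le : {in c &, forall x y, (rho x <= rho y)%N -> (x <= y)%O}.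
  move=> x y xc yc; apply: contraLR; rewrite -ltnNge => nle_xy.
  apply: rho_lt; move: nle_xy.
  rewrite -{1 2}(nth_index \bot%O xc) -{1 2}(nth_index \bot%O yc).
  have [ix iy] : (index x c < size c)%N /\ (index y c < size c)%N.
    by rewrite !index_mem.
  rewrite (lt_sorted_ltn_nth _ c_sorted) // (lt_sorted_leq_nth _ c_sorted) //.
  by rewrite -ltnNge.
(* The inverse map: look up in [c] the entry of rank [i.+1], which exists by the last clause of
   [is_flag_chain]. *)
pose g := [ffun i => if i \in A then nth \bot%O c (find (fun x => rho x == i.+1) c)
                     else \bot%O].
have gP i : i \in A -> g i \in c /\ rho (g i) = i.+1.
  move=> iA; have := c_rho i iA; rewrite ffunE iA => has_i; split.
    by rewrite mem_nth // -has_find.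
  by apply/eqP/(nth_find \bot%O has_i).
have lt_g : {in A &, {homo g : i j / (i < j)%N >-> (i < j)%O}}.
  move=> i j /gP[gic rho_gi] /gP[gjc rho_gj] ij.
  rewrite lt_neqAle c_le ?rho_gi ?rho_gj ?ltnS 1?ltnW // andbT.
  apply: contraTneq ij => gij; move: rho_gi; rewrite gij rho_gj => -[<-].
  by rewrite ltnn.
exists g.
  rewrite inE; apply/flag_selectionP; split=> [i /gP[] // | i iA | i j].
    by rewrite ffunE (negbTE iA).
  exact: lt_g.
(* Strictly sorted sequences with the same members are equal, so only membership is left to
   compare. *)
apply/val_inj/(@irr_sorted_eq _ _ lt_trans ltxx) => //.
  exact: sorted_selection.
move=> x; apply/idP/mapP => [xc | [i]]; last first.
  by rewrite mem_enum => /gP[gi _] ->.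
have /existsP[i /andP[iA /eqP def_x]] := rho_c x xc.
have [gic rho_gi] := gP i iA; exists i; first by rewrite mem_enum.
by apply/le_anti; rewrite !c_le ?rho_gi ?def_x.
Qed.

(** The condition involves [h] alone, not the other inserted elements. Quantifying over all of [S]
    avoids naming the neighbours of [r]. *)
Definition selection_gap S h (r : 'I_n) : {set P} :=
  [set z | rho z == r.+1 &
     [forall s in S, ((s < r)%N ==> (h s < z)%O) && ((r < s)%N ==> (z < h s)%O)]].

(** Selections are fibred over their restriction to [S]. Inside a fibre the choices at the ranks of
    [R] are independent, since separation by [S] makes the inserted elements increase
    automatically. *)
Lemma card_selectionsU S R : [disjoint S & R] ->
  {in R &, forall i j : 'I_n, (i < j)%N -> exists2 s, s \in S & (i < s < j)%N} ->
  #|[set g | is_flag_selection (S :|: R) g]| =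
  (\sum_(h | is_flag_selection S h) \prod_(r in R) #|selection_gap S h r|)%N.
Proof.
move=> dSR sepR.
pose res g : {ffun 'I_n -> P} := [ffun i => if i \in S then g i else \bot%O].
rewrite -sum1_card (partition_big res (is_flag_selection S)) => [|g] /=;
    last first.
  rewrite inE => /flag_selectionP[rho_g _ lt_g]; apply/flag_selectionP.
  split=> [i iS | i iS | i j iS jS ij]; rewrite !ffunE ?iS ?(negbTE iS) //.
    by rewrite rho_g // inE iS.
  by rewrite jS lt_g // inE ?iS ?jS.
apply: eq_bigr => h /flag_selectionP[rho_h bot_h lt_h].
(* The allowed values at each index: forced on [S], free in the gap on [R], padding elsewhere. The
   fibre over [h] is the full product of these sets. *)
pose F i : pred P := if i \in S then pred1 (h i) else
  if i \in R then [pred z in selection_gap S h i] else pred1 \bot%O.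
transitivity #|family F|.
  rewrite -sum1_card; apply: eq_bigl => g; rewrite inE.
  apply/andP/familyP => [[/flag_selectionP[rho_g bot_g lt_g] /eqP res_g] i | gF].
    rewrite /F -res_g; case: ifPn => iS; first by rewrite inE ffunE iS.
    case: ifPn => iR; last by rewrite inE bot_g // inE negb_or iS.
    rewrite !inE rho_g ?eqxx ?inE ?iR ?orbT //=.
    apply/forall_inP => s sS; rewrite ffunE sS.
    by apply/andP; split; apply/implyP; apply: lt_g; rewrite inE ?sS ?iR ?orbT.
  have gS i : i \in S -> g i = h i.
    by move=> iS; have := gF i; rewrite /F iS => /eqP.
  have gR i : i \in R -> i \notin S /\ g i \in selection_gap S h i.
    move=> iR; have iS : i \notin S by rewrite (disjointFl dSR).
    by split=> //; have := gF i; rewrite /F (negbTE iS) iR.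
  have g0 i : i \notin S :|: R -> g i = \bot%O.
    rewrite inE negb_or => /andP[iS iR].
    by have := gF i; rewrite /F (negbTE iS) (negbTE iR) => /eqP.
  have gapl i s : i \in R -> s \in S -> (s < i)%N -> (h s < g i)%O.
    move=> /gR[_]; rewrite inE => /andP[_ /forall_inP gap] /gap/andP[/implyP].
    by [].
  have gapr i s : i \in R -> s \in S -> (i < s)%N -> (g i < h s)%O.
    move=> /gR[_]; rewrite inE => /andP[_ /forall_inP gap] /gap/andP[_ /implyP].
    by [].
  split; last first.
    apply/eqP/ffunP => i; rewrite ffunE.
    by case: ifPn => [/gS | /bot_h].
  apply/flag_selectionP; split=> // [i | i j].
    by case/setUP => [iS | /gR[_]]; [rewrite gS ?rho_h | rewrite inE => /andP[/eqP]].
  case/setUP=> [iS | iR] /setUP[jS | jR] ij.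
  - by rewrite !gS ?lt_h.
  - by rewrite (gS i) ?gapl.
  - by rewrite (gS j) ?gapr.
  (* The chain element at the separating rank gives [g i < h s < g j]. *)
  have [s sS /andP[is_ sj]] := sepR i j iR jR ij.
  exact: lt_trans (gapr _ _ iR sS is_) (gapl _ _ jR sS sj).
rewrite card_family foldrE big_map big_enum /= [RHS]big_mkcond.
apply: eq_bigr => i _; rewrite /F; case: ifPn => iS.
  by rewrite (disjointFr dSR iS) card1.
by case: ifP => // _; rewrite card1.
Qed.
End FlagSelections.

(** * Size of the gaps and separation of [T] *)

Lemma card_selection_gap (d : Order.disp_t) (P : finTBPOrderType d)
  (rho : P -> nat) (n : nat) (S : {set 'I_n}) (h : {ffun 'I_n -> P}) (r : 'I_n) :
  graded_of_rank rho n.+1 -> eulerian rho -> is_flag_selection rho S h ->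
  r \notin S -> (2 <= #|selection_gap rho S h r|)%N.
Proof.
move=> [rho0 rho_cov rho1] rho_eul /flag_selectionP[rho_h _ lt_h] rS.
(* [x] is the value of [h] at the last index of [S] before [r], or the bottom if there is none; [y]
   below is its mirror image. The last clause keeps this origin for the proof of [x <= y]. *)
have [x [xr x_ge x_S]] : exists x, [/\ (rho x < r.+1)%N,
    forall s, s \in S -> (s < r)%N -> (h s <= x)%O
  & x = \bot%O \/ exists s, [/\ s \in S, (s < r)%N & x = h s]].
  case: (pickP [pred s in S | (s < r)%N]) => [s0 s0P | noS]; last first.
    exists \bot%O; rewrite rho0; split=> // [s sS sr|]; last by left.
    by have := noS s; rewrite /= sS sr.
  case: (@arg_maxnP _ s0 [pred s in S | (s < r)%N] val s0P) => s /andP[sS sr] smax.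
  exists (h s); split; [by rewrite rho_h | | by right; exists s].
  move=> t tS tr; have := smax t; rewrite /= tS tr => /(_ isT) /=.
  rewrite leq_eqVlt => /predU1P[/val_inj -> // | ts].
  exact/ltW/lt_h.
have [y [ry y_le y_S]] : exists y, [/\ (r.+1 < rho y)%N,
    forall s, s \in S -> (r < s)%N -> (y <= h s)%O
  & y = \top%O \/ exists s, [/\ s \in S, (r < s)%N & y = h s]].
  case: (pickP [pred s in S | (r < s)%N]) => [s0 s0P | noS]; last first.
    (* The top has rank [n.+1], and [r < n] gives [r.+1 < n.+1]. *)
    exists \top%O; rewrite rho1 ltnS ltn_ord.
    split=> // [s sS sr|]; last by left.
    by have := noS s; rewrite /= sS sr.
  case: (@arg_minnP _ s0 [pred s in S | (r < s)%N] val s0P) => s /andP[sS rs] smin.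
  exists (h s); split; [by rewrite rho_h // ltnS | | by right; exists s].
  move=> t tS rt; have := smin t; rewrite /= tS rt => /(_ isT) /=.
  rewrite leq_eqVlt => /predU1P[/val_inj -> // | st].
  exact/ltW/lt_h.
have xy : (x <= y)%O.
  case: x_S y_S => [-> _ | [s [sS sr ->]] [-> | [t [tS rt ->]]]].
  - exact: le0x.
  - exact: lex1.
  - by apply/ltW/lt_h => //; apply: ltn_trans rt.
have xry : (rho x < r.+1 < rho y)%N by rewrite xr.
apply: leq_trans (card_rank_between rho_cov rho_eul xy xry) _.
apply/subset_leq_card/subsetP => z; rewrite !inE => /andP[/andP[xz zy] ->] /=.
apply/forall_inP => s sS; apply/andP; split; apply/implyP => ?.
  exact: le_lt_trans (x_ge _ _ _) xz.
exact: lt_le_trans zy (y_le _ _ _).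
Qed.

(** Otherwise the whole segment from [i] to [j] lies in [V], its ends by [T \subset V], and a
    maximal interval containing it meets [T] twice. *)
Lemma separated_by_complement n (T V : {set 'I_n}) :
  T \subset V ->
  (forall I : {set 'I_n}, I \in max_intervals V -> (#|I :&: T| <= 1)%N) ->
  {in T &, forall i j : 'I_n, (i < j)%N ->
     exists2 s, s \in ~: V & (i < s < j)%N}.
Proof.
move=> /subsetP TV one_T i j iT jT ij.
have [/existsP[s /and3P[? ? ?]] | noS] :=
  boolP [exists s, [&& s \in ~: V, (i < s)%N & (s < j)%N]].
  by exists s => //; apply/andP.
pose J := [set k : 'I_n | (i <= k <= j)%N].
have JV : J \subset V.
  apply/subsetP => k; rewrite inE leq_eqVlt => /andP[/predU1P[/val_inj <- _ |]].
    exact: TV.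
  move=> ik; rewrite leq_eqVlt => /predU1P[/val_inj -> | kj]; first exact: TV.
  apply: contraR noS => kV; apply/existsP; exists k.
  by rewrite inE kV ik.
have [|I maxI /subsetP JI] := @maxset_exists _ (fun J : {set 'I_n} =>
    [&& J != set0, is_interval J & J \subset V]) J.
  rewrite JV andbT; apply/andP; split.
    by apply/set0Pn; exists i; rewrite inE leqnn ltnW.
  apply/forall_inP => a; rewrite inE => /andP[ia _].
  apply/forall_inP => b; rewrite inE => /andP[_ bj].
  apply/forallP => k; apply/implyP => /andP[ak kb].
  by rewrite inE (leq_trans ia ak) (leq_trans kb bj).
have := one_T I; rewrite inE => /(_ maxI); rewrite leqNgt => /negP[].
apply/card_gt1P; exists i, j; split.
- by rewrite inE iT JI // inE leqnn ltnW.
- by rewrite inE jT JI // inE leqnn ltnW.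
- by apply: contraTneq ij => ->; rewrite ltnn.
Qed.

(** * Evaluation of the two alternating sums *)

Lemma flag_f_sum (d : Order.disp_t) (P : finTBPOrderType d) (rho : P -> nat)
  (n : nat) (S T : {set 'I_n}) :
  (forall x y : P, (x < y)%O -> (rho x < rho y)%N) ->
  [disjoint S & T] ->
  {in T &, forall i j : 'I_n, (i < j)%N -> exists2 s, s \in S & (i < s < j)%N} ->
  \sum_(R : {set 'I_n} | R \subset T)
     (-2) ^+ #|T :\: R| * (flag_f rho (S :|: R))%:R =
  \sum_(h | is_flag_selection rho S h)
     \prod_(r in T) ((#|selection_gap rho S h r|)%:R - 2) :> int.
Proof.
move=> rho_lt dST sepT; under [RHS]eq_bigr do rewrite prodrD_subset.
rewrite exchange_big /=; apply: eq_bigr => R RT.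
rewrite flag_f_selections // card_selectionsU //; last 2 first.
- by rewrite disjoint_sym (disjointWl RT) // disjoint_sym.
- by move=> i j iR jR; apply: sepT; apply: (subsetP RT).
rewrite natr_sum mulr_sumr; apply: eq_bigr => h _.
by rewrite prodr_const natr_prod mulrC.
Qed.

(** After exchanging sums, [Q] runs between [T :|: ~: B] and [V] for fixed [B]. Only the [B] with
    [T :|: ~: B = V] survive, and these are the [~: V :|: R] with [R \subset T]. *)
Lemma flag_L_sum (d : Order.disp_t) (P : finTBPOrderType d) (rho : P -> nat)
  (n : nat) (T V : {set 'I_n}) : T \subset V ->
  (-1) ^+ #|T| * \sum_(Q : {set 'I_n} | (T \subset Q) && (Q \subset V))
                   flag_L rho Q =
  2^-1 ^+ (#|~: V| + #|T|) *
  (\sum_(R : {set 'I_n} | R \subset T)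
     (-2) ^+ #|T :\: R| * (flag_f rho (~: V :|: R))%:R : int)%:~R.
Proof.
move=> TV.
pose X (B : {set 'I_n}) : rat := (- 2^-1) ^+ #|B| * (flag_f rho B)%:R.
have -> : \sum_(Q : {set 'I_n} | (T \subset Q) && (Q \subset V)) flag_L rho Q =
    \sum_(B : {set 'I_n} | T :|: ~: B == V) (-1) ^+ #|~: V| * X B.
  rewrite /flag_L; under eq_bigr => Q _ do rewrite mulr_sumr.
  rewrite (exchange_big_dep predT) //= [RHS]big_mkcond /=.
  apply: eq_bigr => B _; rewrite -mulr_suml.
  have := sum_sign_between rat (T :|: ~: B) V.
  rewrite (eq_big (fun Q : {set 'I_n} =>
            [&& T \subset Q, Q \subset V & ~: Q \subset B])
            (fun Q : {set 'I_n} => (-1) ^+ (n - #|Q|))) => [|Q|Q _]; last 2 first.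
  - by rewrite subUset subCset andbAC -andbA.
  (* The exponent [n - #|Q|] of the L-vector is the size of [~: Q]. *)
  - by rewrite cardsCs setCK card_ord.
  under eq_bigl => Q do rewrite andbA.
  by move=> ->; case: ifP => // _; rewrite mul0r.
(* [R] is recovered from [B] as [B :&: T]. *)
rewrite (reindex_onto (fun R => ~: V :|: R) (fun B => B :&: T)) /=; last first.
  move=> B /eqP/setP TBV; apply/setP => i; move: (TBV i).
  by rewrite !inE; do 3!case: (_ \in _).
rewrite (eq_bigl (fun R : {set 'I_n} => R \subset T)) => [|R]; last first.
  apply/andP/idP => [[_ /eqP <-] | RT]; first exact: subsetIr.
  have RTV i : ((i \in R) ==> (i \in T)) && ((i \in T) ==> (i \in V)).
    by apply/andP; split; apply/implyP; [apply: (subsetP RT) | apply: (subsetP TV)].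
  by split; apply/eqP/setP => i; move: (RTV i); rewrite !inE; do 3!case: (_ \in _).
rewrite rmorph_sum !mulr_sumr; apply: eq_bigr => R RT.
rewrite rmorphM rmorphXn /= rmorph_nat /X.
have -> : #|~: V :|: R| = (#|~: V| + #|R|)%N.
  rewrite -cardsUI [X in (_ + X)%N](_ : _ = 0%N) ?addn0 //.
  apply/eqP; rewrite cards_eq0 setI_eq0 disjoint_sym disjoints_subset setCK.
  exact: subset_trans RT TV.
have -> : #|T| = (#|R| + #|T :\: R|)%N.
  by rewrite -(cardsID R T) (setIidPr RT).
rewrite !mulrA; congr (_ * _).
have -> : (-2 : int)%:~R = -2 :> rat by [].
(* The signs of [R] and of [~: V] each occur twice and cancel; the powers of 2 and of its inverse
   with exponent [#|T :\: R|] cancel as well. *)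
rewrite (exprNn 2^-1) (exprNn 2) !exprD.
have signK k : (-1) ^+ k * (-1) ^+ k = 1 :> rat by rewrite -expr2 sqrr_sign.
have halfK k : 2^-1 ^+ k * 2 ^+ k = 1 :> rat.
  by rewrite -exprMn mulVf ?expr1n.
ring: (signK #|R|) (signK #|~: V|) (halfK #|T :\: R|).
Qed.

Theorem proposition3p1 (n : nat) (T V : {set 'I_n})
  (hTV : T \subset V)
  (hT : forall I : {set 'I_n}, I \in max_intervals V -> (#|I :&: T| <= 1)%N)
  (d : Order.disp_t) (P : finTBPOrderType d) (rho : P -> nat)
  (hgraded : graded_of_rank rho n.+1)
  (heulerian : eulerian rho) :
  let S := ~: V in
  let f_ineq :=
    (0 : int) <= \sum_(R : {set 'I_n} | R \subset T)
                   (-2) ^+ #|T :\: R| * (flag_f rho (S :|: R))%:R in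
  let L_ineq :=
    (0 : rat) <= (-1) ^+ #|T| *
                 \sum_(Q : {set 'I_n} | (T \subset Q) && (Q \subset V))
                   flag_L rho Q in
  f_ineq /\ (f_ineq <-> L_ineq).
Proof.
move=> S f_ineq L_ineq; split; last first.
  (* The two sides differ by a positive power of 1/2, so they have the same sign. *)
  rewrite /L_ineq (flag_L_sum _ hTV) pmulr_rge0 ?exprn_gt0 ?invr_gt0 //.
  by rewrite ler0z.
have [_ rho_cov _] := hgraded.
have dST : [disjoint S & T].
  by rewrite disjoint_sym disjoints_subset setCK.
rewrite /f_ineq (flag_f_sum _ dST (separated_by_complement hTV hT)); last first.
  exact: rank_lt rho_cov.
apply: sumr_ge0 => h hS; apply: prodr_ge0 => r rT.
rewrite subr_ge0 ler_nat; apply: card_selection_gap hgraded heulerian hS _.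
by rewrite inE (subsetP hTV _ rT).
Qed.
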